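(* Let $n\ge 2$, let $\mathbb{P}\in\mathcal{C}_n$, and let $\mathcal{S}\subset\mathbb{R}_{++}$ be a finite set. Then \[ R_n(\mathbb{P})\ \ge\ R_n\ \ge\ R_n(\mathcal{S}),\qquad\text{where}\quad R_n(\mathcal{S}):=\inf_{g\in\mathcal{G}_n(\mathcal{S})}\ \sup_{x,y\in\mathcal{S}}\big\{\phi^{g}(x,y)\ :\ g(\mathbf{z})=g(\mathbf{z}\pi)\ \text{for all permutations }\pi\text{ of }[n]\text{ and all }\mathbf{z}\in\overline{\mathcal{S}}^n\big\}. \]
   Context: Scheduling on two machines with $n$ tasks. A processing-time matrix is $T=(T_{ij})\in\mathbb{R}_{++}^{2\times n}$. An allocation is $X\in\{0,1\}^{2\times n}$ with $X_{1j}+X_{2j}=1$ for all $j$; makespan $M(X,T)=\max_{i\in\{1,2\}}\sum_j X_{ij}T_{ij}$; $M^*(T)=\min_X M(X,T)$. $\mathcal{P}_n$ is the set of Borel probability measures on $\mathbb{R}^n$ supported in $\mathbb{R}_{++}^n$. For $\mathbb{P}\in\mathcal{P}_n$, algorithm $\mathcal{A}^{\mathbb{P}}$ draws $\mathbf{z}\sim\mathbb{P}$ and sends task $j$ to machine 1 iff $T_{1j}/T_{2j}<z_j$ (else to machine 2). $M(\mathbb{P},T)$ is the expected makespan of this allocation, $R_n(\mathbb{P},T)=M(\mathbb{P},T)/M^*(T)$, $R_n(\mathbb{P})=\sup_{T\in\mathbb{R}_{++}^{2\times n}}R_n(\mathbb{P},T)\in[1,\infty]$, $R_n=\inf_{\mathbb{P}\in\mathcal{P}_n}R_n(\mathbb{P})$.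 $\mathcal{C}_n$ is the set of $\mathbb{P}\in\mathcal{P}_n$ invariant under coordinate permutations (if $\mathbf{z}\sim\mathbb{P}$ then $\mathbf{z}\pi:=(z_{\pi(1)},\dots,z_{\pi(n)})\sim\mathbb{P}$ for every permutation $\pi$). For $D\subseteq\mathbb{R}$ put $\overline{D}=D\cup\{0\}\cup\{\infty\}$. For $\mathbf{x}\le\mathbf{y}$ (coordinatewise) let $V_{xy}=\{x_1,y_1\}\times\cdots\times\{x_n,y_n\}$ and for $\mathbf{b}\in V_{xy}$ let $\mathrm{sgn}(\mathbf{b})=1$ if $b_i=x_i$ for an even number of indices $i$ and $-1$ otherwise. A function $G$ is $n$-increasing on $\overline{D}^n$ if $\sum_{\mathbf{b}\in V_{xy}}\mathrm{sgn}(\mathbf{b})G(\mathbf{b})\ge0$ for all $\mathbf{x}\le\mathbf{y}$ in $\overline{D}^n$. For $\mathcal{S}\subseteq\mathbb{R}_{++}$, $\mathcal{G}_n(\mathcal{S})$ is the set of functions $g:\overline{\mathcal{S}}^n\to[0,1]$ that are right continuous on $\overline{\mathcal{S}}^n$, $n$-increasing on $\overline{\mathcal{S}}^n$, satisfy $g(\mathbf{z})=0$ whenever some $z_i=0$, and satisfy $g(\infty,\dots,\infty)=1$. For $g\in\mathcal{G}_n(\mathcal{S})$ and $x,y\in\mathcal{S}$, \[ \phi^{g}(x,y)=1+y-\min\{1,1-\tfrac1x+y\}\,g(x,\infty,\dots,\infty)-y\,g(y,\infty,\dots,\infty)+\min\{1+\tfrac1x,1+y\}\,g(x,y,\infty,\dots,\infty).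 \]
   Formalization: In the definition of n-increasing, the vertices of a box are counted with multiplicity, so boxes with some x_i = y_i contribute 0; summing over the set V_xy literally for all x ≤ y would make G_n(S) empty and the claim false. *)

(* Defs.v *)
From HB Require Import structures.
From mathcomp Require Import all_boot all_order all_algebra all_fingroup.
From mathcomp Require Import all_classical all_reals all_analysis.
Import Order.TTheory GRing.Theory Num.Theory.
Import numFieldNormedType.Exports.

Set Implicit Arguments.
Unset Strict Implicit.
Unset Printing Implicit Defensive.

Local Open Scope ring_scope.
Local Open Scope classical_set_scope.

Section Scheduling.
Variables (R : realType) (n : nat).

(** Processing-time matrices: row 0 = machine 1, row 1 = machine 2. *)
Definition pos_mat (T : 'M[R]_(2, n)) : Prop := forall i j, 0 < T i j.

(** An allocation X with X_{1j}+X_{2j}=1 is encoded by X : 'I_n -> bool,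
    X j = true iff task j goes to machine 1 (X_{1j}=1). *)
Definition makespan (X : 'I_n -> bool) (T : 'M[R]_(2, n)) : R :=
  Num.max (\sum_(j < n | X j) T 0 j) (\sum_(j < n | ~~ X j) T 1 j).

Definition Mstar (T : 'M[R]_(2, n)) : R :=
  \big[Num.min/makespan (fun=> true) T]_(X : {ffun 'I_n -> bool}) makespan X T.

Definition alloc (z : n.-tuple R) (T : 'M[R]_(2, n)) : 'I_n -> bool :=
  fun j => T 0 j / T 1 j < tnth z j.

(** Expected makespan M(P,T). (n.-tuple R carries the product = Borel
    sigma-algebra of R^n.) *)
Definition exp_makespan (P : probability (n.-tuple R) R) (T : 'M[R]_(2, n))
  : \bar R := (\int[P]_z (makespan (alloc z T) T)%:E)%E.

Definition ratio (P : probability (n.-tuple R) R) (T : 'M[R]_(2, n)) : \bar R :=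
  (exp_makespan P T * ((Mstar T)^-1)%:E)%E.

Definition Rn_of (P : probability (n.-tuple R) R) : \bar R :=
  ereal_sup [set ratio P T | T in pos_mat].

Definition supported_pos (P : probability (n.-tuple R) R) : Prop :=
  P [set z | forall j, 0 < tnth z j] = 1%E.

Definition Rn : \bar R :=
  ereal_inf [set Rn_of P | P in [set P : probability (n.-tuple R) R | supported_pos P]].

Definition perm_tuple (pi : {perm 'I_n}) (z : n.-tuple R) : n.-tuple R :=
  [tuple tnth z (pi i) | i < n].

Definition perm_invariant (P : probability (n.-tuple R) R) : Prop :=
  forall (pi : {perm 'I_n}) (A : set (n.-tuple R)), measurable A ->
    P (perm_tuple pi @^-1` A) = P A.

Definition in_Cn (P : probability (n.-tuple R) R) : Prop :=
  supported_pos P /\ perm_invariant P.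

Definition Sbar (S : set R) : set (\bar R) :=
  [set x | (exists2 s, S s & x = s%:E) \/ x = 0%E \/ x = +oo%E].

Definition Sbar_n (S : set R) : set ('I_n -> \bar R) :=
  [set z | forall i, Sbar S (z i)].

Definition right_continuous_on (S : set R) (g : ('I_n -> \bar R) -> R) : Prop :=
  forall z, Sbar_n S z ->
    g @ within [set w : {ptws 'I_n -> \bar R} | Sbar_n S w /\ (forall i, (z i <= w i)%E)]
        (nbhs (z : {ptws 'I_n -> \bar R})) --> g z.

(** n-increasing: sum over vertices b of the box [x,y], b_i = x_i for i in A,
    sgn(b) = (-1)^{#|A|}. *)
Definition n_increasing_on (S : set R) (g : ('I_n -> \bar R) -> R) : Prop :=
  forall x y, Sbar_n S x -> Sbar_n S y -> (forall i, (x i <= y i)%E) ->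
    0 <= \sum_(A : {set 'I_n}) (-1) ^+ #|A| * g (fun i => if i \in A then x i else y i).

Definition in_Gn (S : set R) (g : ('I_n -> \bar R) -> R) : Prop :=
  [/\ forall z, Sbar_n S z -> 0 <= g z <= 1,
      right_continuous_on S g,
      n_increasing_on S g,
      (forall z, Sbar_n S z -> (exists i, z i = 0%E) -> g z = 0) &
      g (fun=> +oo%E) = 1].

Definition g_symmetric (S : set R) (g : ('I_n -> \bar R) -> R) : Prop :=
  forall (pi : {perm 'I_n}) z, Sbar_n S z -> g z = g (fun i => z (pi i)).

Definition pt1 (x : R) : 'I_n -> \bar R :=
  fun i => if val i == 0%N then x%:E else +oo%E.
Definition pt2 (x y : R) : 'I_n -> \bar R :=
  fun i => if val i == 0%N then x%:E else if val i == 1%N then y%:E else +oo%E.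

Definition phi (g : ('I_n -> \bar R) -> R) (x y : R) : R :=
  1 + y - Num.min 1 (1 - x^-1 + y) * g (pt1 x) - y * g (pt1 y)
    + Num.min (1 + x^-1) (1 + y) * g (pt2 x y).

Definition Rn_S (S : set R) : \bar R :=
  ereal_inf [set ereal_sup [set (phi g xy.1 xy.2)%:E | xy in S `*` S]
            | g in [set g | in_Gn S g /\ g_symmetric S g]].

End Scheduling.

(* Main.v *)
(** Given P, let g be the distribution function of P averaged over all
    permutations of the coordinates; it lies in G_n(S) and is symmetric.  For
    a != b consider the instance whose tasks a and b have processing times
    (1, 1/x) and (y, 1) while all other tasks take time e on both machines.  Its
    optimal makespan is at most 1 + n e, and its expected makespan is at least
    that of the tasks a and b alone, which is phi(x, y) computed with the joint
    distribution function of (z_a, z_b).  Let e tend to 0 and average over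
    (a, b) = (pi 0, pi 1): since phi is affine in g, this gives
    phi^g(x, y) <= R_n(P). *)
Require Import Defs.
From HB Require Import structures.
From mathcomp Require Import all_boot all_order all_algebra all_fingroup.
From mathcomp Require Import all_classical all_reals all_analysis.
From mathcomp Require Import measurable_realfun.
From mathcomp Require Import ring lra.
Import Order.TTheory GRing.Theory Num.Theory.
Import numFieldNormedType.Exports.

Local Open Scope ring_scope.
Local Open Scope classical_set_scope.

(** * Expectations of finite combinations of indicators *)

Section Integration.
Context {d : measure_display} {T : measurableType d} {R : realType}.
Variable P : probability T R.

Lemma integrable_scale_indic (c : R) (A : set T) : measurable A ->
  P.-integrable setT (fun w => (c * \1_A w)%:E).
Proof.
move=> mA; under eq_fun do rewrite EFinM.
exact/integrableZl/integrable_indic.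
Qed.

(** Turns pointwise facts on step functions into facts on probabilities; used both for the two-task
    makespan and for [n_increasing_on]. *)
Lemma integral_sum_indic {I : finType} (c : I -> R) (A : I -> set T) :
  (forall i, measurable (A i)) ->
  (\int[P]_w (\sum_i c i * \1_(A i) w)%:E = (\sum_i c i * fine (P (A i)))%:E)%E.
Proof.
move=> mA; under eq_integral do rewrite -sumEFin.
rewrite integral_sum// => [|i]; last exact: integrable_scale_indic.
rewrite -sumEFin; apply: eq_bigr => i _.
under eq_integral do rewrite EFinM.
rewrite integralZl//; last exact: integrable_indic.
by rewrite integral_indic// setIT EFinM fineK// fin_num_measure.
Qed.

Lemma integrable_sum_indic {I : finType} (c : I -> R) (A : I -> set T) :
  (forall i, measurable (A i)) ->
  P.-integrable setT (fun w => (\sum_i c i * \1_(A i) w)%:E).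
Proof.
move=> mA; under eq_fun do rewrite -sumEFin.
by apply: integrable_sum => // i _; exact: integrable_scale_indic.
Qed.

End Integration.

(** * Lower orthants and their signed vertex sums *)

Section Orthants.
Context {R : realType} {n : nat}.
Implicit Types (pi : {perm 'I_n}) (z : 'I_n -> \bar R).

(** Its probability is the distribution function at [z] of the vector with coordinates permuted by
    [pi]. A bound [+oo] drops its constraint, which yields marginals. *)
Definition orthant pi z : set (n.-tuple R) :=
  [set w | forall i, ((tnth w (pi i))%:E <= z i)%E].

Lemma measurable_tnth_le (j : 'I_n) (u : \bar R) :
  measurable [set w : n.-tuple R | ((tnth w j)%:E <= u)%E].
Proof.
have mj : measurable_fun setT (fun w : n.-tuple R => (tnth w j)%:E).
  by apply/measurable_EFinP; exact: measurable_tnth.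
have := mj measurableT _ (emeasurable_itv `]-oo, u]%R).
by rewrite setTI set_itvE.
Qed.

Lemma orthantE pi z :
  orthant pi z = \bigcap_i [set w | ((tnth w (pi i))%:E <= z i)%E].
Proof. by apply/seteqP; split => [w wz i _|w wz i]; exact: wz. Qed.

Lemma measurable_orthant pi z : measurable (orthant pi z).
Proof.
rewrite orthantE; apply: fin_bigcap_measurable => // i _.
exact: measurable_tnth_le.
Qed.

Lemma indic_orthant pi z (w : n.-tuple R) :
  \1_(orthant pi z) w = \prod_i ((tnth w (pi i))%:E <= z i)%E%:R :> R.
Proof.
rewrite indicE; case: (boolP (w \in _)) => [/set_mem wz|].
  by rewrite big1// => i _; rewrite wz.
move=> /negP wz; have [i /negbTE wi] : exists i, ~~ ((tnth w (pi i))%:E <= z i)%E.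
  apply/existsP; rewrite -negb_forall; apply/negP => /forallP wz'.
  by apply: wz; apply/mem_set => i; exact: wz'.
by rewrite (bigD1 i)//= wi mul0r.
Qed.

(** The signed sum is the expansion of a product over the coordinates, with one factor per
    coordinate: the indicator of the bound [y i] minus that of [x i]. Each factor is nonnegative
    since [x i <= y i]. *)
Lemma orthant_ninc pi {x y : 'I_n -> \bar R} (w : n.-tuple R) :
  (forall i, (x i <= y i)%E) ->
  0 <= \sum_(A : {set 'I_n}) (-1) ^+ #|A| *
         \1_(orthant pi (fun i => if i \in A then x i else y i)) w :> R.
Proof.
move=> xy.
suff -> : \sum_(A : {set 'I_n}) (-1) ^+ #|A| *
    \1_(orthant pi (fun i => if i \in A then x i else y i)) w =
  \prod_i (- ((tnth w (pi i))%:E <= x i)%E%:R + ((tnth w (pi i))%:E <= y i)%E%:R) :> R.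
  apply: prodr_ge0 => i _; rewrite addrC subr_ge0 ler_nat.
  by case: (boolP (_ <= x i)%E) => [/le_trans/(_ (xy i)) ->|].
rewrite bigA_distr; apply: eq_bigr => A _.
rewrite indic_orthant -prodr_const big_mkcond -big_split/=.
by apply: eq_bigr => i _; case: ifP => _; rewrite ?mulN1r ?mul1r.
Qed.

End Orthants.

(** * The instance with two significant tasks *)

Section TwoTasks.
Context {R : realType} {n : nat}.
Variables (a b : 'I_n) (x y e : R).
Hypotheses (ab : a != b) (x0 : 0 < x) (y0 : 0 < y) (e0 : 0 < e).

(** The ratios of the two rows at [a] and [b] are exactly [x] and [y], the thresholds at which the
    distribution function is evaluated. *)
Definition two_task_mat : 'M[R]_(2, n) :=
  \matrix_(i < 2, j < n)
    if i == 0 then (if j == a then 1 else if j == b then y else e)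
    else (if j == a then x^-1 else if j == b then 1 else e).

Lemma two_task_mat_pos : pos_mat two_task_mat.
Proof.
by move=> i j; rewrite mxE; do 3?case: ifP => _; rewrite ?invr_gt0.
Qed.

Lemma sum_task_ge (F : 'I_n -> R) (X : 'I_n -> bool) :
  (forall j, 0 <= F j) ->
  (if X a then F a else 0) + (if X b then F b else 0) <= \sum_(j | X j) F j.
Proof.
move=> F0; rewrite big_mkcond (bigD1 a)//= (bigD1 b) 1?eq_sym//=.
by rewrite addrA lerDl sumr_ge0// => j _; case: ifP.
Qed.

(** Discarding the other tasks only lowers the loads; the four values are the makespans of [a] and
    [b] alone. *)
Lemma makespan_two_task_ge (X : 'I_n -> bool) :
  (if X a then if X b then 1 + y else 1
   else if X b then Num.max x^-1 y else 1 + x^-1) <= makespan X two_task_mat.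
Proof.
have T0 i j : 0 <= two_task_mat i j by rewrite ltW ?two_task_mat_pos.
have := sum_task_ge _ X (T0 0); have := sum_task_ge _ (fun j => ~~ X j) (T0 1).
rewrite /makespan !mxE/= !eqxx [b == a]eq_sym (negbTE ab).
set s0 := (\sum_(j | X j) _); set s1 := (\sum_(j | ~~ X j) _).
case: (X a); case: (X b) => /=; rewrite ?addr0 ?add0r => s1ge s0ge;
  rewrite ?ge_max !le_max ?s0ge ?s1ge ?orbT//.
by rewrite addrC s1ge orbT.
Qed.

Lemma Mstar_two_task_gt0 : 0 < Mstar two_task_mat.
Proof.
have M0 X : 0 < makespan X two_task_mat.
  apply: lt_le_trans (makespan_two_task_ge X).
  have x1 : 0 < x^-1 by rewrite invr_gt0.
  by do 2?[case: ifP => _]; rewrite ?lt_max ?x1 ?addr_gt0.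
by apply/bigmin_gtP; split.
Qed.

Lemma Mstar_two_task_le : Mstar two_task_mat <= 1 + n%:R * e.
Proof.
(* Send [a] to machine 1 and everything else to machine 2: the loads are 1, and 1 plus the small
   tasks. *)
apply: le_trans (bigmin_le _ [ffun j => j == a] _) _; rewrite /makespan ge_max.
apply/andP; split.
  rewrite (eq_bigl (pred1 a)); last by move=> j; rewrite ffunE.
  by rewrite big_pred1_eq mxE /= eqxx lerDl mulr_ge0// ltW.
rewrite (bigD1 b)/=; last by rewrite ffunE eq_sym.
rewrite mxE/= eq_sym (negbTE ab) eqxx lerD2l.
apply: (@le_trans _ _ (\sum_(j < n) e)).
  rewrite big_mkcond; apply: ler_sum => j _; rewrite ffunE mxE/=.
  by case: (j == a) => /=; [rewrite ltW|case: (j == b); rewrite //= ltW].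
by rewrite sumr_const card_ord mulr_natl.
Qed.

Lemma alloc_two_task (w : n.-tuple R) :
  (alloc w two_task_mat a = (x < tnth w a)) *
  (alloc w two_task_mat b = (y < tnth w b)).
Proof.
rewrite /alloc !mxE/= !eqxx [b == a]eq_sym (negbTE ab).
by rewrite div1r invrK divr1.
Qed.

End TwoTasks.
Arguments two_task_mat_pos {R n a b x y e}.
Arguments makespan_two_task_ge {R n a b x y e}.
Arguments Mstar_two_task_gt0 {R n a b x y e}.
Arguments Mstar_two_task_le {R n a b x y e}.
Arguments alloc_two_task {R n a b} x y e.

Lemma measurable_makespan {R : realType} {n : nat} (T : 'M[R]_(2, n)) :
  measurable_fun setT (fun w : n.-tuple R => makespan (alloc w T) T).
Proof.
have mX j : measurable_fun setT (fun w : n.-tuple R => alloc w T j).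
  by apply: measurable_fun_ltr => //; exact: measurable_tnth.
rewrite /makespan; apply: measurable_maxr.
  under eq_fun do rewrite big_mkcond.
  by apply: measurable_sum => j; exact: measurable_fun_ifT.
under eq_fun do rewrite big_mkcond.
apply: measurable_sum => j.
under eq_fun do rewrite if_neg.
exact: measurable_fun_ifT.
Qed.

Lemma le_of_le_mul1D {R : realFieldType} (k c r : R) : 0 <= k ->
  (forall e, 0 < e -> c <= r * (1 + k * e)) -> c <= r.
Proof.
move=> k0 cr; apply/ler_addgt0Pr => e e0.
have k1 : 0 < k + 1 by rewrite ltr_wpDl.
have r1 : 0 < `|r| + 1 by rewrite ltr_wpDl.
(* At this value the error [r * k * _] is at most [e]; the added ones keep the denominator
   positive. *)
have d0 : 0 < e / ((k + 1) * (`|r| + 1)) by rewrite divr_gt0 ?mulr_gt0.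
apply: le_trans (cr _ d0) _; rewrite mulrDr mulr1 lerD2l.
rewrite !mulrA ler_pdivrMr ?mulr_gt0//.
have rk : r * k <= (`|r| + 1) * (k + 1).
  apply: (@le_trans _ _ (`|r| * k)); first by rewrite ler_wpM2r ?ler_norm.
  by apply: ler_pM => //; rewrite lerDl.
by rewrite [(k + 1) * _]mulrC [r * k * e]mulrC ler_wpM2l// ltW.
Qed.

(** * Lower bound on [Rn_of P] from a pair of tasks *)

Section LowerBound.
Context {R : realType} {n : nat}.
Variable P : probability (n.-tuple R) R.

Lemma two_task_le_Rn_of (a b : 'I_n) (x y : R) : a != b -> 0 < x -> 0 < y ->
  ((1 + y - Num.min 1 (1 - x^-1 + y) * fine (P [set w | tnth w a <= x])
     - y * fine (P [set w | tnth w b <= y])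
     + Num.min (1 + x^-1) (1 + y)
       * fine (P ([set w | tnth w a <= x] `&` [set w | tnth w b <= y])))%:E
   <= Rn_of P)%E.
Proof.
move=> ab x0 y0; set A := [set w | tnth w a <= x].
set B := [set w | tnth w b <= y]; set c := (X in X%:E).
have mA : measurable A by have := measurable_tnth_le a x%:E.
have mB : measurable B by have := measurable_tnth_le b y%:E.
have mAB : measurable (A `&` B) by exact: measurableI.
(* Makespan of [a] and [b] alone under the allocation drawn from [w]. *)
pose h (w : n.-tuple R) : R :=
  if x < tnth w a then if y < tnth w b then 1 + y else 1
  else if y < tnth w b then Num.max x^-1 y else 1 + x^-1.
(* Inclusion-exclusion coefficients of [h] over [setT], [A], [B] and [A] intersected with [B]. On
   [A] alone, [1 + y] minus the first minimum is the maximum of [x^-1] and [y]; on the intersection,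
   that maximum plus the minimum of the two is their sum. *)
pose cs := nth (0 : R) [:: 1 + y; - Num.min 1 (1 - x^-1 + y); - y;
  Num.min (1 + x^-1) (1 + y)].
pose As := nth (set0 : set (n.-tuple R)) [:: setT; A; B; A `&` B].
have mAs (i : 'I_4) : measurable (As i) by rewrite /As; case: i => -[|[|[|[|k]]]] ? //=.
have hE w : h w = \sum_(i < 4) cs i * \1_(As i) w.
  have wA : (w \in A) = ~~ (x < tnth w a) by rewrite -leNgt; exact: asboolb.
  have wB : (w \in B) = ~~ (y < tnth w b) by rewrite -leNgt; exact: asboolb.
  have -> : \sum_(i < 4) cs i * \1_(As i) w =
      1 + y - Num.min 1 (1 - x^-1 + y) * (w \in A)%:R - y * (w \in B)%:R
      + Num.min (1 + x^-1) (1 + y) * ((w \in A) && (w \in B))%:R.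
    rewrite !big_ord_recl big_ord0 /cs /As /= !indicE in_setT in_setI.
    by rewrite /=; ring.
  rewrite wA wB /h; case: ltP => _; case: ltP => _ /=;
    rewrite ?mulr0 ?mulr1 /Num.min /Num.max;
    by do ?[case: ifPn; rewrite -?leNgt => ?]; lra.
have cI : c%:E = (\int[P]_w (h w)%:E)%E.
  under eq_integral do rewrite hE.
  rewrite integral_sum_indic//; congr (_%:E).
  rewrite !big_ord_recl big_ord0 /cs /As /=.
  by rewrite probability_setT /= /c; ring.
have h0 w : 0 <= h w.
  have x1 : 0 < x^-1 by rewrite invr_gt0.
  rewrite /h; do 2?case: ifP => _; rewrite ?le_max ?addr_ge0// ?ltW//.
have cE e : 0 < e -> (c%:E <= exp_makespan P (two_task_mat a b x y e))%E.
  move=> e0; rewrite cI; apply: ge0_le_integral => //=.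
  - by move=> w _; rewrite lee_fin.
  - under eq_fun do rewrite hE.
    exact/measurable_int/integrable_sum_indic.
  - by apply/measurable_EFinP; exact: measurable_makespan.
  - move=> w _; rewrite lee_fin.
    have := makespan_two_task_ge ab x0 y0 e0 (alloc w (two_task_mat a b x y e)).
    by rewrite !(alloc_two_task _ _ _ ab).
have c0 : 0 <= c by rewrite -lee_fin cI integral_ge0// => w _; rewrite lee_fin.
have cR e : 0 < e ->
    (c%:E * ((Mstar (two_task_mat a b x y e))^-1)%:E <= Rn_of P)%E.
  move=> e0.
  have : (Defs.ratio P (two_task_mat a b x y e) <= Rn_of P)%E.
    by apply: ereal_sup_ubound; exists (two_task_mat a b x y e) => //; exact: two_task_mat_pos.
  apply: le_trans; apply: lee_wpmul2r; last exact: cE.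
  by rewrite lee_fin invr_ge0 ltW// Mstar_two_task_gt0.
(* The supremum may be infinite: [+oo] is trivial, and the instance with [e = 1] excludes [-oo]. *)
case: (Rn_of P) cR => [r| |] cR; last 2 first.
- exact: leey.
- by have := cR 1 ltr01; rewrite leeNy_eq.
rewrite lee_fin; apply: (@le_of_le_mul1D _ n%:R _ _) => // e e0.
have M0 : 0 < Mstar (two_task_mat a b x y e) by exact: Mstar_two_task_gt0.
have := cR e e0; rewrite -EFinM lee_fin => cMr.
(* The sign of [r] permits replacing [Mstar] by its upper bound [1 + n%:R * e]. *)
have r0 : 0 <= r by apply: le_trans cMr; rewrite divr_ge0// ltW.
rewrite ler_pdivrMr// in cMr; apply: le_trans cMr _.
by rewrite ler_wpM2l// Mstar_two_task_le.
Qed.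

End LowerBound.

(** * The symmetrised distribution function *)

Section SymmetricCdf.
Context {R : realType} {n : nat}.
Variable P : probability (n.-tuple R) R.
Implicit Types (pi : {perm 'I_n}) (z : 'I_n -> \bar R) (S : set R).

(** The infimum [Rn] ranges over all probabilities on positive vectors, so symmetry is created by
    averaging. *)
Definition sym_cdf z : R :=
  #|{perm 'I_n}|%:R^-1 * \sum_(pi : {perm 'I_n}) fine (P (orthant pi z)).

Lemma card_perm_gt0 : 0 < #|{perm 'I_n}|%:R :> R.
Proof. by rewrite ltr0n; apply/card_gt0P; exists 1%g. Qed.

Lemma fine_probability_itv (A : set (n.-tuple R)) : measurable A ->
  0 <= fine (P A) <= 1.
Proof.
move=> mA; rewrite fine_ge0//= -lee_fin fineK ?fin_num_measure//.
exact: probability_le1.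
Qed.

Lemma sym_cdf_itv z : 0 <= sym_cdf z <= 1.
Proof.
have F pi := fine_probability_itv _ (measurable_orthant pi z).
apply/andP; split.
  apply: mulr_ge0; first by rewrite invr_ge0 ltW ?card_perm_gt0.
  by apply: sumr_ge0 => pi _; case/andP: (F pi).
rewrite /sym_cdf mulrC ler_pdivrMr ?card_perm_gt0// mul1r -sum1_card natr_sum.
by apply: ler_sum => pi _; case/andP: (F pi).
Qed.

Lemma sym_cdf_perm z pi : sym_cdf z = sym_cdf (fun i => z (pi i)).
Proof.
(* Permuting the bounds by [pi] is absorbed by the translation [s] to [pi * s] of the summation
   index. *)
congr (_ * _); rewrite [RHS](reindex_inj (mulgI pi))/=.
apply: eq_bigr => s _; congr (fine (P _)).
apply/seteqP; split => w wz i.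
  by rewrite permM; exact: wz.
by have := wz ((pi^-1)%g i); rewrite permM permKV.
Qed.

Lemma sym_cdf_pinfty : sym_cdf (fun=> +oo%E) = 1.
Proof.
rewrite /sym_cdf (eq_bigr (fun=> 1)) => [|pi _].
  by rewrite sumr_const mulVf// gt_eqF ?card_perm_gt0.
have -> : orthant pi (fun=> +oo%E) = [set: n.-tuple R].
  by apply/seteqP; split => // w _ i; exact: leey.
by rewrite probability_setT.
Qed.

Lemma sym_cdf_eq0 z : supported_pos P -> (exists i, z i = 0%E) -> sym_cdf z = 0.
Proof.
move=> P0 [i zi]; rewrite /sym_cdf big1 ?mulr0// => pi _.
pose pos := [set w : n.-tuple R | forall j, 0 < tnth w j].
have {}P0 : P pos = 1%E by [].
have mpos : measurable pos.
  suff -> : pos = \bigcap_(j : 'I_n) ~` [set w | ((tnth w j)%:E <= 0)%E].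
    apply: fin_bigcap_measurable => // j _.
    by apply: measurableC; exact: measurable_tnth_le.
  apply/seteqP; split => w.
    by move=> wpos j _ /=; apply/negP; rewrite lee_fin -ltNge; exact: wpos.
  by move=> wpos j; have /= /negP := wpos j I; rewrite lee_fin -ltNge.
(* A zero bound forces a coordinate to be at most 0, so the orthant misses the positive vectors,
   which carry all the mass. *)
have : (P (orthant pi z) <= P (~` pos))%E.
  apply: le_measure; rewrite ?inE; [exact: measurable_orthant|exact: measurableC|].
  move=> w wz wpos; have := wz i; rewrite zi lee_fin leNgt.
  by rewrite wpos.
rewrite probability_setC// P0 subee// measure_le0 => /eqP ->.
by rewrite fine0.
Qed.

Lemma sym_cdf_increasing S : n_increasing_on S sym_cdf.
Proof.
move=> x y _ _ xy.
under eq_bigr do rewrite mulrCA mulr_sumr.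
rewrite -mulr_sumr exchange_big; apply: mulr_ge0 => /=.
  by rewrite invr_ge0 ltW ?card_perm_gt0.
(* For each [pi] the signed sum is the integral of the function that [orthant_ninc] shows
   nonnegative. *)
apply: sumr_ge0 => pi _; rewrite -lee_fin -integral_sum_indic => [|A].
  by apply: integral_ge0 => w _; rewrite lee_fin orthant_ninc.
exact: measurable_orthant.
Qed.

End SymmetricCdf.

(** * Discreteness of the finite grid *)

Lemma finite_Sbar {R : realType} (S : set R) : finite_set S -> finite_set (Sbar S).
Proof.
move=> fS; suff -> : Sbar S = EFin @` S `|` [set 0%E; +oo%E].
  by rewrite finite_setU; split; [exact: finite_image|exact: finite_set2].
apply/seteqP; split => u /=.
  by case=> [[s Ss ->]|[->|->]]; [left; exists s|right; left|right; right].
by case=> [[s Ss <-]|[->|->]]; [left; exists s|right; left|right; right].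
Qed.

(** Finite sets are closed in an accessible space, so each [z i] has a neighbourhood avoiding the
    other points of [D]; the finitely many coordinate conditions are then intersected. *)
Lemma nbhs_finite_grid {I : finType} {K : topologicalType} (D : set K)
    (z : {ptws I -> K}) : accessible_space K -> finite_set D ->
  nbhs z [set w | (forall i, D (w i)) -> w = z].
Proof.
move=> K1 fD.
have zi i : \forall w \near z, D (w i) -> w i = z i.
  have cl : closed (D `\ z i).
    by have /accessible_finite_set_closed := K1; apply; exact: finite_setD.
  have zV : nbhs (z i) (~` (D `\ z i)).
    by apply: open_nbhs_nbhs; split; [exact: closed_openC|case=> _; apply].
  have := @proj_continuous I (fun=> K) i z _ zV.
  apply: (@filterS _ (nbhs z)) => w wDz Dw.
  by apply: contrapT => wz; apply: wDz.
have zA : nbhs z [set w | forall i, D (w i) -> w i = z i].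
  exact: (@filter_forall _ _ _ (nbhs z)).
apply: (@filterS _ (nbhs z) _ _ _ _ zA) => w wz Dw.
by apply/funext => i; exact: wz.
Qed.

(* A finite grid is discrete, so continuity on it is automatic. *)
Lemma right_continuous_finite {R : realType} {n : nat} (S : set R)
  (g : ('I_n -> \bar R) -> R) : finite_set S -> right_continuous_on S g.
Proof.
move=> fS z _ U Uz.
have K1 := hausdorff_accessible (@ereal_hausdorff R).
have zS := @nbhs_finite_grid 'I_n _ _ z K1 (finite_Sbar _ fS).
apply: (@filterS _ (nbhs (z : {ptws 'I_n -> \bar R})) _ _ _ _ zS).
move=> w wz [Sw _]; rewrite (wz Sw); exact: (nbhs_singleton Uz).
Qed.

(** * Averaging over pairs of tasks and conclusion *)

Section MainBound.
Context {R : realType} {n : nat}.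
Variable P : probability (n.-tuple R) R.

Lemma phi_sym_cdf_le (x y : R) : (2 <= n)%N -> 0 < x -> 0 < y ->
  ((phi (sym_cdf P) x y)%:E <= Rn_of P)%E.
Proof.
move=> n2 x0 y0.
pose i0 := Ordinal (ltnW n2); pose i1 := Ordinal n2.
have i01 : i0 != i1 by [].
pose psi (pi : {perm 'I_n}) := 1 + y
  - Num.min 1 (1 - x^-1 + y) * fine (P [set w | tnth w (pi i0) <= x])
  - y * fine (P [set w | tnth w (pi i1) <= y])
  + Num.min (1 + x^-1) (1 + y) *
    fine (P ([set w | tnth w (pi i0) <= x] `&` [set w | tnth w (pi i1) <= y])).
have psi_le pi : ((psi pi)%:E <= Rn_of P)%E.
  by apply: two_task_le_Rn_of; rewrite ?(inj_eq perm_inj).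
have N0 := @card_perm_gt0 R n.
have phiE : phi (sym_cdf P) x y = #|{perm 'I_n}|%:R^-1 * \sum_pi psi pi.
  (* [phi] evaluates both one-point marginals at coordinate 0. By symmetry the one at [y] moves to
     coordinate 1, matching task [pi i1] in [psi pi]. *)
  have -> : phi (sym_cdf P) x y = 1 + y
    - Num.min 1 (1 - x^-1 + y) * sym_cdf P (pt1 x)
    - y * sym_cdf P (fun i => pt1 y (tperm i0 i1 i))
    + Num.min (1 + x^-1) (1 + y) * sym_cdf P (pt2 x y) by rewrite -sym_cdf_perm.
  have i0P (i : 'I_n) : val i == 0%N -> i = i0 by move=> /eqP ?; exact: val_inj.
  have i1P (i : 'I_n) : val i == 1%N -> i = i1 by move=> /eqP ?; exact: val_inj.
  have Ex pi : orthant pi (pt1 x) = [set w : n.-tuple R | tnth w (pi i0) <= x].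
    apply/seteqP; split => w wx; first by have := wx i0; rewrite lee_fin.
    move=> i; rewrite /pt1; case: ifP => [/i0P ->|_]; last exact: leey.
    by rewrite lee_fin.
  have Ey pi : orthant pi (fun i => pt1 y (tperm i0 i1 i)) =
      [set w : n.-tuple R | tnth w (pi i1) <= y].
    apply/seteqP; split => w wy.
      by have := wy i1; rewrite tpermR /pt1/= lee_fin.
    move=> i; rewrite /pt1; case: ifP => [/i0P ii0|_]; last exact: leey.
    by rewrite lee_fin -[i](tpermK i0 i1) ii0 tpermL.
  have Exy pi : orthant pi (pt2 x y) = [set w : n.-tuple R | tnth w (pi i0) <= x]
      `&` [set w | tnth w (pi i1) <= y].
    apply/seteqP; split => w.
      by move=> wxy; split; [have := wxy i0|have := wxy i1]; rewrite lee_fin.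
    move=> [wx wy] i; rewrite /pt2; case: ifP => [/i0P ->|_]; first by rewrite lee_fin.
    by case: ifP => [/i1P ->|_]; [rewrite lee_fin|exact: leey].
  rewrite /sym_cdf /psi !big_split/= !sumrN -!mulr_sumr !sumr_const.
  under eq_bigr do rewrite Ex.
  under [X in y * (_ * X)]eq_bigr do rewrite Ey.
  under [X in _ + _ * (_ * X) = _]eq_bigr do rewrite Exy.
  rewrite -[1 *+ _]mulr_natr -[y *+ _]mulr_natr.
  by field; rewrite gt_eqF.
(* A mean of numbers at most [r] is at most [r]; the identity permutation excludes [-oo]. *)
rewrite phiE; case: (Rn_of P) psi_le => [r| |] psi_le.
- rewrite lee_fin mulrC ler_pdivrMr// mulr_natr -sumr_const.
  by apply: ler_sum => pi _; rewrite -lee_fin.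
- exact: leey.
- by have := psi_le 1%g; rewrite leeNy_eq.
Qed.

End MainBound.

Theorem theorem6 (R : realType) (n : nat) (P : probability (n.-tuple R) R)
    (S : set R) :
  (2 <= n)%N -> in_Cn P -> finite_set S -> S `<=` [set x | 0 < x] ->
  (Rn R n <= Rn_of P)%E /\ (Rn_S n S <= Rn R n)%E.
Proof.
move=> n2 [P0 _] fS S0; split; first by apply: ereal_inf_lbound; exists P.
apply: le_ereal_inf_tmp => _ [Q Q0 <-].
(* For each competitor [Q] in [Rn], [sym_cdf Q] is the candidate in the infimum [Rn_S]. *)
apply: (@le_trans _ _ (ereal_sup [set (phi (sym_cdf Q) xy.1 xy.2)%:E | xy in S `*` S])).
  apply: ereal_inf_lbound; exists (sym_cdf Q) => //; split.
    split.
    - by move=> z _; exact: sym_cdf_itv.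
    - exact: right_continuous_finite.
    - exact: sym_cdf_increasing.
    - by move=> z _; exact: sym_cdf_eq0.
    - exact: sym_cdf_pinfty.
  by move=> pi z _; exact: sym_cdf_perm.
apply: ge_ereal_sup => _ [[x y] [/= Sx Sy] <-].
by apply: phi_sym_cdf_le => //; exact: S0.
Qed.
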